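(* Let $R$ be a ring, let $\Gamma_R$ be its universal valuation semiring, and let $\nu : R \to \Gamma_R$ be the map $\nu(r) = [x_r]$. Then $(\Gamma_R,\nu)$ is initial among valuations of $R$: $\nu$ is a (nondegenerate) valuation, and for any idempotent semiring $\hat\Gamma$ and any (nondegenerate) valuation $\hat\nu : R \to \hat\Gamma$ there exists a unique semiring homomorphism $\phi : \Gamma_R \to \hat\Gamma$ such that $\hat\nu = \phi \circ \nu$.
   Context: Rings and semirings are unital and not necessarily commutative. A semiring $(S,+,*,0_S,1_S)$ has $(S,+,0_S)$ a commutative monoid, $(S,*,1_S)$ a monoid, multiplication distributing over addition on both sides, and $0_S$ annihilating multiplicatively. Semiring homomorphisms preserve $+$, $*$, $0$ and $1$. A semiring is idempotent if $a+a=a$ for all $a$; it then carries the partial order $a \le b \iff a+b=a$. A valuation from a ring $R$ to an idempotent semiring $\Gamma$ is a function $\nu : R\to\Gamma$ with: $\nu(0)=0$ and $\nu(1)=1=\nu(-1)$; $\nu(ab)=\nu(a)\nu(b)$; and $\nu(a+b)\ge \nu(a)+\nu(b)$ (equivalently $\nu(a+b)+\nu(a)+\nu(b)=\nu(a)+\nu(b)$). It is nondegenerate if $\nu^{-1}(0_\Gamma)=\{0_R\}$. Convention: all valuations are nondegenerate. Let $\mathbb{B}$ be the boolean semiring $\{0,1\}$ with $1+1=1$. For a ring $R$, take a variable $x_a$ for each $a\in R$, and let $\mathbb{B}\langle x_R\rangle$ be the non-commutative polynomial semiring over $\mathbb{B}$ in these variables (elements are finite sums, with idempotent addition, of words in the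 variables; multiplication is concatenation extended distributively). A congruence on a semiring $S$ is an equivalence relation that is a subsemiring of $S\times S$. The universal valuation semiring is $\Gamma_R=\mathbb{B}\langle x_R\rangle/\sim$, where $\sim$ is the smallest congruence containing the relations, for all $a,b\in R$: $x_0\sim 0$, $x_1\sim 1$, $x_{-1}\sim 1$, $x_ax_b\sim x_{ab}$, $x_{a+b}+x_a+x_b\sim x_a+x_b$. The class of an element $y$ is written $[y]$. *)

(* Defs.v *)
From HB Require Import structures.
From mathcomp Require Import all_boot all_order all_algebra finmap.
From mathcomp Require Import boolp.

Set Implicit Arguments.
Unset Strict Implicit.
Unset Printing Implicit Defensive.

Import GRing.Theory.

Local Open Scope ring_scope.
Local Open Scope quotient_scope.

(* pzSemiRingType and pzRingType are used throughout (rather than the nz       *)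
(* versions): the zero ring and the zero semiring are allowed.                 *)

HB.mixin Record PzSemiRing_isIdempotent S of GRing.PzSemiRing S := {
  addxx : idempotent_op (@GRing.add S)
}.

#[short(type="idemSemiRingType")]
HB.structure Definition IdemSemiRing :=
  { S of GRing.PzSemiRing S & PzSemiRing_isIdempotent S }.

(* Note the direction: addition computes the infimum of this order, and 0 is   *)
(* its greatest element.                                                       *)
Definition idem_le (G : idemSemiRingType) (a b : G) : Prop := a + b = a.

Record valuation (R : pzRingType) (G : idemSemiRingType) (nu : R -> G) : Prop :=
  Valuation {
    valuation0 : nu 0 = 0;
    valuation1 : nu 1 = 1;
    valuationN1 : nu (-1) = 1;
    valuationM : {morph nu : a b / a * b};
    valuationD : forall a b, idem_le (nu a + nu b) (nu (a + b))
  }.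

Definition nondegenerate_map (R : pzRingType) (G : idemSemiRingType) (nu : R -> G) :
  Prop := forall a, nu a = 0 <-> a = 0.

(* B<X>, the non-commutative polynomials over the boolean semiring. A finitely *)
(* supported B-valued function on the words in X is the same as a finite set   *)
(* of words; sums are then unions and products are elementwise concatenations. *)
Definition bool_ncpoly (X : choiceType) : Type := {fset seq X}.

Section BoolNCPoly.
Variable X : choiceType.
Local Notation P := (bool_ncpoly X).

HB.instance Definition _ := Choice.on P.

Definition ncpoly_add (A B : P) : P := (A `|` B)%fset.
Definition ncpoly_mul (A B : P) : P := [fset u ++ v | u in A, v in B]%fset.
Definition ncpoly_zero : P := fset0.
Definition ncpoly_one : P := [fset [::]]%fset.
Definition ncpoly_var (x : X) : P := [fset [:: x]]%fset.

Lemma ncpoly_addA : associative ncpoly_add. Proof. exact: fsetUA. Qed.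
Lemma ncpoly_addC : commutative ncpoly_add. Proof. exact: fsetUC. Qed.
Lemma ncpoly_add0 : left_id ncpoly_zero ncpoly_add. Proof. exact: fset0U. Qed.

HB.instance Definition _ :=
  GRing.isNmodule.Build P ncpoly_addA ncpoly_addC ncpoly_add0.

Lemma ncpoly_mulP (A B : P) (w : seq X) :
  reflect (exists2 u, u \in (A : {fset seq X}) &
             exists2 v, v \in (B : {fset seq X}) & w = u ++ v)
          (w \in (ncpoly_mul A B : {fset seq X})).
Proof.
exact: imfset2P.
Qed.

Lemma ncpoly_mulA : associative ncpoly_mul.
Proof.
move=> A B C; apply/fsetP => w; apply/ncpoly_mulP/ncpoly_mulP.
  case=> u Au [_ /ncpoly_mulP[v Bv [t Ct ->]] ->].
  exists (u ++ v); last by exists t; rewrite // catA.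
  by apply/ncpoly_mulP; exists u => //; exists v.
case=> _ /ncpoly_mulP[u Au [v Bv ->]] [t Ct ->].
exists u => //; exists (v ++ t); last by rewrite catA.
by apply/ncpoly_mulP; exists v => //; exists t.
Qed.

Lemma ncpoly_mul1l : left_id ncpoly_one ncpoly_mul.
Proof.
move=> A; apply/fsetP => w; apply/ncpoly_mulP/idP.
  by case=> _ /fset1P-> [v Av ->].
by move=> Aw; exists [::]; [rewrite inE | exists w].
Qed.

Lemma ncpoly_mul1r : right_id ncpoly_one ncpoly_mul.
Proof.
move=> A; apply/fsetP => w; apply/ncpoly_mulP/idP.
  by case=> u Au [_ /fset1P-> ->]; rewrite cats0.
by move=> Aw; exists w => //; exists [::]; [rewrite inE | rewrite cats0].
Qed.

Lemma ncpoly_mulDl : left_distributive ncpoly_mul ncpoly_add.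
Proof.
move=> A B C; apply/fsetP => w; apply/ncpoly_mulP/fsetUP.
  by case=> u /fsetUP[Au|Bu] [v Cv ->]; [left|right];
     apply/ncpoly_mulP; exists u => //; exists v.
by case=> /ncpoly_mulP[u Au [v Cv ->]];
   exists u; rewrite ?inE ?Au ?orbT //; exists v.
Qed.

Lemma ncpoly_mulDr : right_distributive ncpoly_mul ncpoly_add.
Proof.
move=> A B C; apply/fsetP => w; apply/ncpoly_mulP/fsetUP.
  by case=> u Au [v /fsetUP[Bv|Cv] ->]; [left|right];
     apply/ncpoly_mulP; exists u => //; exists v.
by case=> /ncpoly_mulP[u Au [v Bv ->]];
   exists u => //; exists v; rewrite // !inE Bv ?orbT.
Qed.

Lemma ncpoly_mul0l : left_zero ncpoly_zero ncpoly_mul.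
Proof. by move=> A; apply/fsetP => w; apply/ncpoly_mulP; rewrite inE => -[]. Qed.

Lemma ncpoly_mul0r : right_zero ncpoly_zero ncpoly_mul.
Proof.
by move=> A; apply/fsetP => w; apply/ncpoly_mulP; rewrite inE => -[u _ []].
Qed.

HB.instance Definition _ := GRing.Nmodule_isPzSemiRing.Build P
  ncpoly_mulA ncpoly_mul1l ncpoly_mul1r ncpoly_mulDl ncpoly_mulDr
  ncpoly_mul0l ncpoly_mul0r.

Lemma ncpoly_addxx : idempotent_op (@GRing.add P).
Proof. exact: fsetUid. Qed.

HB.instance Definition _ := PzSemiRing_isIdempotent.Build P ncpoly_addxx.

End BoolNCPoly.

Section Congruence.
Variable S : pzSemiRingType.

Definition congruence (C : rel S) : Prop :=
  equivalence_rel C /\ GRing.semiring_closed [pred p : S * S | C p.1 p.2].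

Definition gen_congr (r : S -> S -> Prop) : rel S := fun x y =>
  `[< forall C : rel S,
        congruence C -> (forall a b, r a b -> C a b) -> C x y >].

Variable r : S -> S -> Prop.

Lemma gen_congr_sub a b : r a b -> gen_congr r a b.
Proof. by move=> rab; apply/asboolP => C _; apply. Qed.

Lemma gen_congr_min (C : rel S) : congruence C ->
  (forall a b, r a b -> C a b) -> forall a b, gen_congr r a b -> C a b.
Proof. by move=> congC rC a b /asboolP; apply. Qed.

Lemma gen_congr_refl : reflexive (gen_congr r).
Proof. by move=> x; apply/asboolP => C [eqC _] _; case: (eqC x x x). Qed.

Lemma gen_congr_sym : symmetric (gen_congr r).
Proof.
have sym x y : gen_congr r x y -> gen_congr r y x.
  move=> /asboolP cxy; apply/asboolP => C cC rC.
  have Cxy := cxy C cC rC; case: cC => eqC _.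
  by have [Cxx <-] := eqC x y x.
by move=> x y; apply/idP/idP; apply: sym.
Qed.

Lemma gen_congr_trans : transitive (gen_congr r).
Proof.
move=> y x z /asboolP cxy /asboolP cyz; apply/asboolP => C cC rC.
have Cxy := cxy C cC rC; have Cyz := cyz C cC rC; case: cC => eqC _.
by have [_ ->] := eqC x y z.
Qed.

Canonical gen_congr_equiv :=
  EquivRel (gen_congr r) gen_congr_refl gen_congr_sym gen_congr_trans.

Lemma gen_congrD x1 x2 y1 y2 : gen_congr r x1 x2 -> gen_congr r y1 y2 ->
  gen_congr r (x1 + y1) (x2 + y2).
Proof.
move=> /asboolP cx /asboolP cy; apply/asboolP => C cC rC.
have Cx := cx C cC rC; have Cy := cy C cC rC; case: cC => _ [[_ addC] _].
exact: (addC (x1, x2) (y1, y2)).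
Qed.

Lemma gen_congrM x1 x2 y1 y2 : gen_congr r x1 x2 -> gen_congr r y1 y2 ->
  gen_congr r (x1 * y1) (x2 * y2).
Proof.
move=> /asboolP cx /asboolP cy; apply/asboolP => C cC rC.
have Cx := cx C cC rC; have Cy := cy C cC rC; case: cC => _ [_ [_ mulC]].
exact: (mulC (x1, x2) (y1, y2)).
Qed.

Lemma gen_congrP : congruence (gen_congr r).
Proof.
split.
  move=> x y z; split; first exact: gen_congr_refl.
  move=> cxy; apply/idP/idP; last exact: gen_congr_trans.
  by apply: gen_congr_trans; rewrite gen_congr_sym.
by do 2!split; rewrite ?inE ?gen_congr_refl //= => -[x1 x2] [y1 y2];
  rewrite !inE; [apply: gen_congrD | apply: gen_congrM].
Qed.

Definition congr_quot : Type := {eq_quot gen_congr_equiv}.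
Local Notation Q := congr_quot.

HB.instance Definition _ := Choice.on Q.
HB.instance Definition _ : EqQuotient S gen_congr_equiv Q := EqQuotient.on Q.

Definition quot_zero : Q := lift_cst Q 0.
Definition quot_one : Q := lift_cst Q 1.
Definition quot_add := lift_op2 Q (@GRing.add S).
Definition quot_mul := lift_op2 Q (@GRing.mul S).

Canonical pi_quot_zero_morph := PiConst quot_zero.
Canonical pi_quot_one_morph := PiConst quot_one.

Lemma gen_congr_repr x : gen_congr r x (repr (\pi_Q x)).
Proof. by apply/(@eqmodP _ gen_congr_equiv); rewrite reprK. Qed.

Lemma pi_quot_add : {morph \pi_Q : x y / x + y >-> quot_add x y}.
Proof.
move=> x y; unlock quot_add; apply/eqmodP; apply: gen_congrD (gen_congr_repr _) (gen_congr_repr _).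
Qed.
Canonical pi_quot_add_morph := PiMorph2 pi_quot_add.

Lemma pi_quot_mul : {morph \pi_Q : x y / x * y >-> quot_mul x y}.
Proof.
move=> x y; unlock quot_mul; apply/eqmodP; apply: gen_congrM (gen_congr_repr _) (gen_congr_repr _).
Qed.
Canonical pi_quot_mul_morph := PiMorph2 pi_quot_mul.

Lemma quot_addA : associative quot_add.
Proof.
by move=> x y z; rewrite -[x]reprK -[y]reprK -[z]reprK !piE addrA.
Qed.
Lemma quot_addC : commutative quot_add.
Proof. by move=> x y; rewrite -[x]reprK -[y]reprK !piE addrC. Qed.
Lemma quot_add0 : left_id quot_zero quot_add.
Proof. by move=> x; rewrite -[x]reprK !piE add0r. Qed.

HB.instance Definition _ := GRing.isNmodule.Build Q quot_addA quot_addC quot_add0.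

Lemma quot_mulA : associative quot_mul.
Proof.
by move=> x y z; rewrite -[x]reprK -[y]reprK -[z]reprK !piE mulrA.
Qed.
Lemma quot_mul1l : left_id quot_one quot_mul.
Proof. by move=> x; rewrite -[x]reprK !piE mul1r. Qed.
Lemma quot_mul1r : right_id quot_one quot_mul.
Proof. by move=> x; rewrite -[x]reprK !piE mulr1. Qed.
Lemma quot_mulDl : left_distributive quot_mul quot_add.
Proof.
by move=> x y z; rewrite -[x]reprK -[y]reprK -[z]reprK !piE mulrDl.
Qed.
Lemma quot_mulDr : right_distributive quot_mul quot_add.
Proof.
by move=> x y z; rewrite -[x]reprK -[y]reprK -[z]reprK !piE mulrDr.
Qed.
Lemma quot_mul0l : left_zero quot_zero quot_mul.
Proof. by move=> x; rewrite -[x]reprK !piE mul0r. Qed.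
Lemma quot_mul0r : right_zero quot_zero quot_mul.
Proof. by move=> x; rewrite -[x]reprK !piE mulr0. Qed.

HB.instance Definition _ := GRing.Nmodule_isPzSemiRing.Build Q
  quot_mulA quot_mul1l quot_mul1r quot_mulDl quot_mulDr quot_mul0l quot_mul0r.

End Congruence.

Lemma quot_addxx (S : idemSemiRingType) (r : S -> S -> Prop) :
  idempotent_op (@GRing.add (congr_quot r)).
Proof.
move=> x; rewrite -[x]reprK; apply: etrans (esym (pi_quot_add _ _ _)) _.
by rewrite addxx.
Qed.

HB.instance Definition _ (S : idemSemiRingType) (r : S -> S -> Prop) :=
  PzSemiRing_isIdempotent.Build (congr_quot r) (@quot_addxx S r).

Section UniversalValuation.
Variable R : pzRingType.
Local Notation x_ a := (@ncpoly_var R a).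

Inductive valuation_rel : bool_ncpoly R -> bool_ncpoly R -> Prop :=
| ValRel0 : valuation_rel (x_ 0) 0
| ValRel1 : valuation_rel (x_ 1) 1
| ValRelN1 : valuation_rel (x_ (-1)) 1
| ValRelM a b : valuation_rel (x_ a * x_ b) (x_ (a * b))
| ValRelD a b : valuation_rel (x_ (a + b) + x_ a + x_ b) (x_ a + x_ b).

Definition univ_valuation_semiring := congr_quot valuation_rel.
HB.instance Definition _ := IdemSemiRing.on univ_valuation_semiring.

Definition univ_valuation (a : R) : univ_valuation_semiring :=
  \pi_(congr_quot valuation_rel) (x_ a).

End UniversalValuation.

(* Main.v *)
(** Existence and uniqueness come from the fact that the words in the [x_a] span
    [B<x_R>] additively.  Nondegeneracy of [nu] uses the nondegenerate valuation
    [a |-> Z a] with values in the additive subgroups of [R] (sums and products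
    of subgroups): the kernel congruence of the map sending a polynomial to the
    subgroup spanned by the values of its words contains the defining relations,
    so [x_a ~ 0] forces [Z a = 0]. *)
Require Import Defs.
From HB Require Import structures.
From mathcomp Require Import all_boot all_order all_algebra finmap boolp.

Set Implicit Arguments.
Unset Strict Implicit.
Unset Printing Implicit Defensive.

Import GRing.Theory.

Local Open Scope ring_scope.
Local Open Scope quotient_scope.

(** * Homomorphisms into and out of a quotient semiring *)

Lemma congruence_ker (S T : pzSemiRingType) (f : {rmorphism S -> T}) :
  congruence [rel x y | f x == f y].
Proof.
split; first by move=> x y z /=; split=> [|/eqP->].
by do 2!split; rewrite ?inE //= => -[x1 x2] [y1 y2] /eqP /= ex /eqP /= ey;
  rewrite inE /= ?rmorphD ?rmorphM ex ey.
Qed.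

Section QuotientProjection.
Variables (S : pzSemiRingType) (r : S -> S -> Prop).
Local Notation pi := (\pi_(congr_quot r)).

Lemma pi_quot_nmod : nmod_morphism pi.
Proof. by split; [rewrite -[0 in RHS]/(quot_zero r) piE | apply: pi_quot_add]. Qed.

Lemma pi_quot_monoid : monoid_morphism pi.
Proof. by split; [rewrite -[1 in RHS]/(quot_one r) piE | apply: pi_quot_mul]. Qed.

End QuotientProjection.

Section QuotientLift.
Variables (S T : pzSemiRingType) (r : S -> S -> Prop) (f : {rmorphism S -> T}).
Hypothesis rf : forall x y, r x y -> f x = f y.

(* The proof argument is kept, although unused, so that the morphism structures
   declared below can be attached to [quot_lift rf]. *)
Definition quot_lift of (forall x y, r x y -> f x = f y) :=
  fun x : congr_quot r => f (repr x).

(** The kernel of [f] is a congruence containing [r], hence contains [gen_congr r]; so [f] cannot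
    tell [x] from the chosen representative of its class. *)
Lemma quot_liftE x : quot_lift rf (\pi_(congr_quot r) x) = f x.
Proof.
apply/esym/eqP; apply: (gen_congr_min (congruence_ker f) _ (gen_congr_repr r x)).
by move=> a b rab /=; apply/eqP/rf.
Qed.

Lemma quot_lift_nmod : nmod_morphism (quot_lift rf).
Proof.
split=> [|x y]; first by rewrite -(pi_quot_nmod r).1 quot_liftE rmorph0.
by rewrite -[x]reprK -[y]reprK -[_ + _]pi_quot_add !quot_liftE rmorphD.
Qed.

Lemma quot_lift_monoid : monoid_morphism (quot_lift rf).
Proof.
split=> [|x y]; first by rewrite -(pi_quot_monoid r).1 quot_liftE rmorph1.
by rewrite -[x]reprK -[y]reprK -[_ * _]pi_quot_mul !quot_liftE rmorphM.
Qed.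

HB.instance Definition _ :=
  GRing.isNmodMorphism.Build (congr_quot r) T (quot_lift rf) quot_lift_nmod.
HB.instance Definition _ :=
  GRing.isMonoidMorphism.Build (congr_quot r) T (quot_lift rf) quot_lift_monoid.

End QuotientLift.

(** * Evaluation of non-commutative boolean polynomials *)

Section NCPolyEval.
Variables (X : choiceType) (G : idemSemiRingType) (g : X -> G).
Local Notation P := (bool_ncpoly X).

Definition word_eval (w : seq X) : G := \prod_(a <- w) g a.

Definition ncpoly_eval (A : P) : G := \sum_(w <- (A : {fset seq X})) word_eval w.

(** Idempotent addition makes a sum depend only on the set of its indices. Unions and products can
    thus be evaluated on plain lists, where repeated words do no harm. *)
Lemma ncpoly_eval_mem (A : P) (s : seq (seq X)) :
  (A : {fset seq X}) =i s -> ncpoly_eval A = \sum_(w <- s) word_eval w.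
Proof. by move=> As; apply: eq_big_idem As; apply: addxx. Qed.

Lemma ncpoly_eval_nmod : nmod_morphism ncpoly_eval.
Proof.
split=> [|A B]; first by rewrite (@ncpoly_eval_mem _ [::]) ?big_nil.
rewrite (@ncpoly_eval_mem _ ((A : {fset _}) ++ (B : {fset _}))) ?big_cat //.
by move=> w; rewrite mem_cat; apply: in_fsetU.
Qed.

Lemma ncpoly_eval_monoid : monoid_morphism ncpoly_eval.
Proof.
split=> [|A B].
  rewrite (@ncpoly_eval_mem _ [:: [::]]) ?big_seq1 /word_eval ?big_nil //.
  by move=> w; rewrite !inE.
(* Different pairs may concatenate to the same word; the list keeps all pairs, so that its sum
   factors by distributivity. *)
rewrite (@ncpoly_eval_mem _ [seq u ++ v | u <- (A : {fset _}), v <- (B : {fset _})]).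
  rewrite big_allpairs_dep mulr_suml; apply: eq_bigr => u _.
  by rewrite mulr_sumr; apply: eq_bigr => v _; apply: big_cat.
move=> w; apply/ncpoly_mulP/allpairsP => [[u Au [v Bv ->]]|[[u v] [Au Bv ->]]].
  by exists (u, v).
by exists u => //; exists v.
Qed.

HB.instance Definition _ :=
  GRing.isNmodMorphism.Build P G ncpoly_eval ncpoly_eval_nmod.
HB.instance Definition _ :=
  GRing.isMonoidMorphism.Build P G ncpoly_eval ncpoly_eval_monoid.

Lemma ncpoly_eval_var x : ncpoly_eval (ncpoly_var x) = g x.
Proof.
rewrite (@ncpoly_eval_mem _ [:: [:: x]]) ?big_seq1 /word_eval ?big_seq1 //.
by move=> w; rewrite !inE.
Qed.

End NCPolyEval.

Lemma mem_word_eval_var (X : choiceType) (w t : seq X) :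
  (t \in (word_eval (@ncpoly_var X) w : {fset seq X})) = (t == w).
Proof.
elim: w t => [|a w IHw] t; first by rewrite /word_eval big_nil inE.
rewrite /word_eval big_cons; apply/ncpoly_mulP/eqP.
  by case=> _ /fset1P-> [v]; rewrite IHw => /eqP-> ->.
move->; exists [:: a]; first by rewrite inE.
by exists w; rewrite ?IHw.
Qed.

Lemma ncpoly_eval_id (X : choiceType) (A : bool_ncpoly X) :
  ncpoly_eval (@ncpoly_var X) A = A.
Proof.
have mem_sum (s : seq (seq X)) w :
    (w \in (\sum_(v <- s) word_eval (@ncpoly_var X) v : {fset _})) = (w \in s).
  elim: s => [|v s IHs]; first by rewrite big_nil.
  by rewrite big_cons in_cons -IHs [LHS]in_fsetU mem_word_eval_var.
by apply/fsetP => w; apply: mem_sum.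
Qed.

(** Each polynomial is the sum of its words and each word the product of its variables; the
    projection respects both. A homomorphism on the quotient is therefore determined by its values
    on the classes of variables. *)
Lemma univ_valuation_span (R : pzRingType) (A : bool_ncpoly R) :
  \pi_(univ_valuation_semiring R) A = ncpoly_eval (@univ_valuation R) A.
Proof.
rewrite -[in LHS](ncpoly_eval_id A) /ncpoly_eval.
rewrite (big_morph _ (pi_quot_nmod _).2 (pi_quot_nmod _).1).
apply: eq_bigr => w _; exact: (big_morph _ (pi_quot_monoid _).2 (pi_quot_monoid _).1).
Qed.

(** * The congruence of spanning the same additive subgroup *)

Section SubgroupSpan.
Variable R : pzRingType.
Local Notation P := (bool_ncpoly R).

Definition word_prod (w : seq R) : R := \prod_(a <- w) a.

Definition words_in (A : P) (H : R -> Prop) : Prop :=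
  forall w, w \in (A : {fset seq R}) -> H (word_prod w).

Definition subgroup (H : R -> Prop) : Prop :=
  H 0 /\ forall a b, H a -> H b -> H (a - b).

(* A set of words spans the intersection of the subgroups containing its values;
   quantifying over those subgroups avoids naming the span. *)
Definition same_span : rel P := fun A B =>
  `[< forall H, subgroup H -> words_in A H <-> words_in B H >].

Lemma words_inD A B H : words_in (A + B) H <-> words_in A H /\ words_in B H.
Proof.
split=> [AB|[HA HB] w /fsetUP[/HA|/HB] //].
by split=> w ww; apply: AB; apply/fsetUP; [left | right].
Qed.

(** Fixing the right factor turns a condition on the product into one on [A] alone, tested against
    the preimage of [H] under a right multiplication. If [H] is a subgroup, so is this preimage. *)
Lemma words_inMl A B H : words_in (A * B) H <->
  forall v, v \in (B : {fset seq R}) -> words_in A (fun a => H (a * word_prod v)).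
Proof.
split=> [AB v Bv u Au | AB _ /ncpoly_mulP[u Au [v Bv ->]]].
  by rewrite /word_prod -big_cat; apply: AB; apply/ncpoly_mulP; exists u => //; exists v.
by rewrite /word_prod big_cat; apply: AB.
Qed.

Lemma words_inMr A B H : words_in (A * B) H <->
  forall u, u \in (A : {fset seq R}) -> words_in B (fun b => H (word_prod u * b)).
Proof.
rewrite words_inMl; split=> AB u uu w ww; exact: AB.
Qed.

Lemma words_in_var a (H : R -> Prop) : words_in (ncpoly_var a) H <-> H a.
Proof.
split=> [/(_ [:: a])|Ha w /fset1P->]; rewrite /word_prod big_seq1 //.
by apply; rewrite inE.
Qed.

Lemma words_in1 (H : R -> Prop) : words_in 1 H <-> H 1.
Proof.
split=> [/(_ [::])|Ha w /fset1P->]; rewrite /word_prod big_nil //.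
by apply; rewrite inE.
Qed.

Lemma words_in0 (H : R -> Prop) : words_in 0 H.
Proof. by move=> w; rewrite inE. Qed.

Lemma subgroupN H a : subgroup H -> H (- a) <-> H a.
Proof.
move=> [H0 HB]; have HN b : H b -> H (- b) by rewrite -sub0r; apply: HB.
by split=> /HN; rewrite ?opprK.
Qed.

Lemma subgroupD H a b : subgroup H -> H a -> H b -> H (a + b).
Proof. by move=> sH Ha Hb; rewrite -[b]opprK; apply: sH.2 => //; apply/subgroupN. Qed.

Lemma subgroup_mulr H c : subgroup H -> subgroup (fun a => H (a * c)).
Proof.
by move=> [H0 HB]; split=> [|a b Ha Hb]; rewrite ?mul0r // mulrBl; apply: HB.
Qed.

Lemma subgroup_mull H c : subgroup H -> subgroup (fun a => H (c * a)).
Proof.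
by move=> [H0 HB]; split=> [|a b Ha Hb]; rewrite ?mulr0 // mulrBr; apply: HB.
Qed.

Lemma same_span_congruence : congruence same_span.
Proof.
split.
  move=> A B C; split; first by apply/asboolP.
  move=> /asboolP AB; apply/asboolP/asboolP => sp H sH.
    by rewrite -AB // sp.
  by rewrite AB // sp.
do 2!split; rewrite ?inE /=; try exact/asboolP;
  move=> [A A'] [B B']; rewrite !inE /= => /asboolP AA' /asboolP BB';
  apply/asboolP => H sH.
  by rewrite !words_inD AA' // BB'.
(* The factors are exchanged one at a time, through the mixed product. *)
apply: (iff_trans (B := words_in (A' * B) H)).
  rewrite !words_inMl; split=> AB v Bv; apply/AA'; try exact: AB;
  exact: subgroup_mulr.
rewrite !words_inMr; split=> AB u Au; apply/BB'; try exact: AB;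
exact: subgroup_mull.
Qed.

Lemma valuation_rel_same_span A B : valuation_rel A B -> same_span A B.
Proof.
move=> rAB; apply/asboolP => H sH; case: rAB => [||| a b | a b].
- by rewrite words_in_var; split=> [_|_]; [apply: words_in0 | apply: sH.1].
- by rewrite words_in_var words_in1.
- by rewrite words_in_var words_in1 subgroupN.
- rewrite words_inMl words_in_var; split=> [|Hab v /fset1P->].
    move=> /(_ [:: b]); rewrite words_in_var /word_prod big_seq1; apply.
    by rewrite inE.
  by rewrite words_in_var /word_prod big_seq1.
(* The extra summand changes nothing: a subgroup with [a] and [b] contains [a + b]. *)
rewrite !words_inD !words_in_var; split=> [[[_ Ha] Hb] //|[Ha Hb]].
by do 2!split=> //; apply: subgroupD.
Qed.

End SubgroupSpan.

(** * The universal valuation and its initiality *)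

Lemma univ_valuationP (R : pzRingType) : valuation (@univ_valuation R).
Proof.
have rel A B : valuation_rel A B ->
    \pi_(univ_valuation_semiring R) A = \pi_(univ_valuation_semiring R) B.
  by move=> rAB; apply/eqmodP/gen_congr_sub.
split; rewrite /univ_valuation.
- by rewrite (rel _ _ (ValRel0 _)) (pi_quot_nmod _).1.
- by rewrite (rel _ _ (ValRel1 _)) (pi_quot_monoid _).1.
- by rewrite (rel _ _ (ValRelN1 _)) (pi_quot_monoid _).1.
- by move=> a b; rewrite -(rel _ _ (ValRelM a b)) (pi_quot_monoid _).2.
move=> a b; rewrite /idem_le -!(pi_quot_nmod _).2 addrC addrA.
exact: rel (ValRelD a b).
Qed.

Lemma univ_valuation_nondegenerate (R : pzRingType) :
  nondegenerate_map (@univ_valuation R).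
Proof.
move=> a; split=> [|->]; last exact: (valuation0 (univ_valuationP R)).
rewrite -(pi_quot_nmod (@valuation_rel R)).1 => /eqmodP.
move=> /(gen_congr_min (@same_span_congruence R) (@valuation_rel_same_span R)).
(* Testing against the zero subgroup suffices: it contains the values of the words of the zero
   polynomial vacuously, hence also [a]. *)
move=> /asboolP /(_ (fun r => r = 0)) [].
  by split=> // _ _ -> ->; rewrite subr0.
by move=> _ /(_ (@words_in0 _ _)) /words_in_var.
Qed.

Theorem proposition7 (R : pzRingType) :
  [/\ valuation (@univ_valuation R),
      nondegenerate_map (@univ_valuation R) &
      forall (G : idemSemiRingType) (nu : R -> G),
        valuation nu -> nondegenerate_map nu ->
        exists2 phi : {rmorphism univ_valuation_semiring R -> G},
          nu =1 phi \o @univ_valuation R &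
          forall psi : {rmorphism univ_valuation_semiring R -> G},
            nu =1 psi \o @univ_valuation R -> psi =1 phi].
Proof.
split; [exact: univ_valuationP | exact: univ_valuation_nondegenerate |].
move=> G nu nuP _.
(* Evaluation at [nu] turns each defining relation into a valuation axiom, so it descends to the
   quotient. *)
have rel_eval A B : valuation_rel A B -> ncpoly_eval nu A = ncpoly_eval nu B.
  case=> [||| a b | a b]; rewrite ?rmorph0 ?rmorph1 ?rmorphD ?rmorphM /= !ncpoly_eval_var.
  - exact: valuation0.
  - exact: valuation1.
  - exact: valuationN1.
  - by rewrite valuationM.
  by rewrite -addrA addrC; apply: valuationD.
have phiE a : nu a = quot_lift rel_eval (univ_valuation a).
  by rewrite quot_liftE /= ncpoly_eval_var.
exists (quot_lift rel_eval) => // psi psiE x.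
(* Both maps commute with the sums and products that express [x] through classes of variables, where
   they agree with [nu]. *)
rewrite -[x]reprK univ_valuation_span /ncpoly_eval !rmorph_sum.
apply: eq_bigr => w _; rewrite /word_eval !rmorph_prod.
by apply: eq_bigr => a _; rewrite -[LHS]psiE phiE.
Qed.
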